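(* Let $s,t\ge0$ be integers with $k=s+t\ge1$, $\Lambda=s\Lambda_0+t\Lambda_1$, and let $L\ge0$ be an integer. Let $C$ be the Cartan matrix of $sl(k)$, $C_{ij}=2\delta_{ij}-\delta_{i,j+1}-\delta_{i,j-1}$ ($1\le i,j\le k-1$), write $x^t=(x_1,\dots,x_{k-1})$ (transpose of the column vector $x$), and let $e_i$ be the $i$-th unit vector of dimension $k-1$, with $e_0=e_k=0$. Define $F_{j,L}(\Lambda)$ by $$\mathrm{ch}_L(\Lambda)=\sum_{j\in\mathbb Z}z^{-j}F_{j,L}(\Lambda).$$ Then, the sums below being over non-negative integers $x_1,\dots,x_{k-1}$ subject to the indicated condition: If $L$ is even, $$F_{j,L}(\Lambda)=\sum_{\sum_{i=1}^{k-1}ix_i\in j+k\mathbb Z} q^{x^tC^{-1}x-x^tC^{-1}e_s+\frac{j(j+t)}k}\,{L \brack x_0\cdots x_k},$$ where $x_0=\frac L2-\frac1k\bigl(\sum_{i=1}^{k-1}(k-i)x_i+j\bigr)$ and $x_k=\frac L2-\frac1k\bigl(\sum_{i=1}^{k-1}ix_i-j\bigr)$. If $L$ is odd, $$F_{j,L}(\Lambda)=\sum_{\sum_{i=1}^{k-1}ix_i\in j+t+k\mathbb Z} q^{x^tC^{-1}x-x^tC^{-1}e_t+\frac{j(j+t)}k}\,{L \brack x_0\cdots x_k},$$ where $x_0=\frac{L+1}2-\frac1k\bigl(\sum_{i=1}^{k-1}(k-i)x_i+j+t\bigr)$ and $x_k=\frac{L-1}2-\frac1k\bigl(\sum_{i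=1}^{k-1}ix_i-j-t\bigr)$.
   Context: Paths. $\Lambda_0,\Lambda_1$ are the fundamental weights of $\widehat{sl}(2)$; extend the index by $\Lambda_i=\Lambda_{i'}$ for $i\equiv i' \pmod 2$. Put $\widehat 0=\Lambda_1-\Lambda_0$, $\widehat 1=\Lambda_0-\Lambda_1$, and $P_k=\{a_0\Lambda_0+a_1\Lambda_1\mid a_0,a_1\in\mathbb Z,\ a_0+a_1=k\}$. For $\Lambda=s\Lambda_0+t\Lambda_1$ ($k=s+t$) and $L\ge0$, $\mathcal P_L(\Lambda)$ is the set of sequences $p=(p_0,\dots,p_{L+1})$ with all $p_i\in P_k$, $p_{i+1}-p_i=m_i\widehat0+(k-m_i)\widehat1$ for some $m_i\in\{0,1,\dots,k\}$ ($0\le i\le L$), and $p_i=s\Lambda_i+t\Lambda_{i+1}$ for $i=L,L+1$. Write $\mu_i(p)=m_i$. The ground-state path $\bar p\in\mathcal P_L(\Lambda)$ is $\bar p_i=s\Lambda_i+t\Lambda_{i+1}$ for all $0\le i\le L+1$. The energy of $p\in\mathcal P_L(\Lambda)$ is $$E(p)=\sum_{j=1}^L j\Bigl(\max\bigl(k-\mu_{j-1}(p),\mu_j(p)\bigr)-\max\bigl(k-\mu_{j-1}(\bar p),\mu_j(\bar p)\bigr)\Bigr).$$ Character. $\mathrm{ch}_L(\Lambda)=\mathrm{ch}_L(\Lambda)(z,q)=\sum_{p\in\mathcal P_L(\Lambda)}z^{(\Lambda-p_0\mid\Lambda_1)}q^{E(p)}$, where for $p\in\mathcal P_L(\Lambda)$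 one has $p_0=\Lambda+j\alpha_1$ with $\alpha_1=2\Lambda_1-2\Lambda_0$, $j\in\mathbb Z$, and $(\Lambda-p_0\mid\Lambda_1)=-j$. With $(q)_m=\prod_{j=1}^m(1-q^j)$, the $q$-multinomial coefficient is ${M\brack m_1\cdots m_n}=\dfrac{(q)_M}{\prod_{j}(q)_{m_j}}$ if all $m_j$ are non-negative integers with $m_1+\cdots+m_n=M$, and $0$ otherwise. *)

(* Defs.v *)
From mathcomp Require Import all_boot all_order all_algebra fraction archimedean.
From mathcomp Require Import finmap ring zify.
From mathcomp Require Import boolp classical_sets cardinality fsbigop.
From mathcomp Require Import monalg.

Set Implicit Arguments.
Unset Strict Implicit.
Unset Printing Implicit Defensive.

Import Order.TTheory GRing.Theory Num.Theory.

Local Open Scope classical_set_scope.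
Local Open Scope ring_scope.

(* The pair (a0, a1) stands for a0 Lambda_0 + a1 Lambda_1. *)
Notation weight := (int * int)%type.

Definition Lam (i : nat) : weight := if odd i then (0, 1) else (1, 0).

Definition hat0 : weight := Lam 1 - Lam 0.
Definition hat1 : weight := Lam 0 - Lam 1.

Definition Plevel (k : nat) : set weight := [set a : weight | a.1 + a.2 = k%:Z].

(* The standard invariant form of sl(2)^: (Lambda_0 | Lambda_0) =
   (Lambda_0 | Lambda_1) = 0 and (Lambda_1 | Lambda_1) = 1/2, so that
   (alpha_1 | Lambda_1) = 1 for alpha_1 = 2 Lambda_1 - 2 Lambda_0. *)
Definition form (a b : weight) : rat := (a.2 * b.2)%:~R / 2.

Definition ground (s t i : nat) : weight := Lam i *+ s + Lam i.+1 *+ t.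

Definition step (k m : nat) : weight := hat0 *+ m + hat1 *+ (k - m).

Definition paths (s t L : nat) : set ((L.+2).-tuple weight) :=
  let k := (s + t)%N in
  [set p : (L.+2).-tuple weight |
    [/\ forall i, (i <= L.+1)%N -> Plevel k p`_i,
        forall i, (i <= L)%N ->
          exists2 m, (m <= k)%N & p`_i.+1 - p`_i = step k m,
        p`_L = ground s t L
      & p`_L.+1 = ground s t L.+1 ] ].
Arguments paths : clear implicits.

Definition ground_path (s t L : nat) : (L.+2).-tuple weight :=
  [tuple ground s t i | i < L.+2].

(* The number m_i with p_{i+1} - p_i = step k m_i; it is unique because
   step k is injective. *)
Definition mu (k : nat) (p : seq weight) (i : nat) : nat :=
  if [pick m : 'I_k.+1 | p`_i.+1 - p`_i == step k m] is Some m then m else 0%N.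

Definition energy (s t L : nat) (p : seq weight) : int :=
  let k := (s + t)%N in
  let pb := ground_path s t L in
  \sum_(1 <= j < L.+1)
    j%:Z * ((maxn (k - mu k p j.-1) (mu k p j))%:Z
          - (maxn (k - mu k pb j.-1) (mu k pb j))%:Z).

(* The field Q(q). *)
Definition Kq : fieldType := {fraction {poly rat}}.
Definition q : Kq := tofrac 'X.

(* Meant for integral e only; every exponent that occurs is an integer, see
   expo_int_even and expo_int_odd. *)
Definition qpow (e : rat) : Kq := q ^ Num.floor e.

Definition qfact (m : nat) : Kq := \prod_(1 <= j < m.+1) (1 - q ^+ j).

Definition qmultinomial (M : nat) (ms : seq rat) : Kq :=
  if all (fun m => m \is a Num.nat) ms && (\sum_(m <- ms) m == M%:R)
  then qfact M / \prod_(m <- ms) qfact (Num.truncn m)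
  else 0.

(* An element of {malg Kq[rat]} is a finite formal sum of terms c z^r with
   c in Q(q); the term c z^r is written << c *g r >>. *)
Definition ch (s t L : nat) : {malg Kq[rat]} :=
  \sum_(p \in paths s t L)
    << q ^ energy s t L p *g form (ground s t 0 - p`_0) (Lam 1) >>.

(* The coefficient of z^{-j}; ch_expand shows that these coefficients
   determine ch. *)
Definition F (s t L : nat) (j : int) : Kq := (ch s t L)@_(- j%:~R).

(* Row and column i : 'I_(k - 1) carry the index i + 1. *)
Definition cartan (k : nat) : 'M[rat]_k.-1 :=
  \matrix_(i, j) (2 * (i == j)%:R - (i == j.+1 :> nat)%:R
                                  - (i.+1 == j :> nat)%:R).

(* e_r for 0 <= r <= k; it vanishes for r = 0 and r = k. *)
Definition unitv (k r : nat) : 'cV[rat]_k.-1 := \col_i (i.+1 == r)%:R.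

(* x^t C^{-1} x - x^t C^{-1} e_r + j (j + t) / k *)
Definition expo (k r t : nat) (j : int) (x : 'cV[nat]_k.-1) : rat :=
  let xv : 'cV[rat]_k.-1 := map_mx (fun n => n%:R) x in
  (xv^T *m invmx (cartan k) *m xv) 0 0
  - (xv^T *m invmx (cartan k) *m unitv k r) 0 0
  + (j * (j + t%:Z))%:~R / k%:R.

Definition wsum (k : nat) (x : 'cV[nat]_k.-1) : nat :=
  \sum_(i < k.-1) i.+1 * x i 0%R.

Definition cowsum (k : nat) (x : 'cV[nat]_k.-1) : nat :=
  \sum_(i < k.-1) (k - i.+1) * x i 0%R.

(* The sequence x_0, x_1, ..., x_k with given end entries. *)
Definition extend (k : nat) (x0 : rat) (x : 'cV[nat]_k.-1) (xk : rat)
  : seq rat := x0 :: rcons [seq (x i 0)%:R | i : 'I_k.-1] xk.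

Lemma weightD_snd (a b : weight) : (a + b).2 = a.2 + b.2.
Proof. by []. Qed.

Lemma weightB_snd (a b : weight) : (a - b).2 = a.2 - b.2.
Proof. by []. Qed.

Lemma weightMn_snd (a : weight) n : (a *+ n).2 = a.2 * n%:Z.
Proof.
elim: n => [|n IHn]; first by rewrite mulr0.
by rewrite mulrS weightD_snd IHn; lia.
Qed.

Lemma Lam_snd i : (Lam i).2 = (odd i)%:Z.
Proof. by rewrite /Lam; case: (odd i). Qed.

Lemma ground_snd s t i :
  (ground s t i).2 = (if odd i then s else t)%:Z.
Proof.
rewrite /ground weightD_snd !weightMn_snd !Lam_snd [odd i.+1]/=.
by case: (odd i) => /=; lia.
Qed.

Lemma step_snd k m : (m <= k)%N -> (step k m).2 = 2 * m%:Z - k%:Z.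
Proof.
move=> le_mk; rewrite /step /hat0 /hat1 weightD_snd !weightMn_snd !weightB_snd.
by rewrite !Lam_snd /=; lia.
Qed.

Lemma finite_paths s t L : finite_set (paths s t L).
Proof.
pose k := (s + t)%N.
pose g (m : {ffun 'I_L.+1 -> 'I_k.+1}) : (L.+2).-tuple weight :=
  [tuple ground s t L.+1 - \sum_(i <= l < L.+1) step k (m (inord l)) | i < L.+2].
apply: (@sub_finite_set _ _ [set g m | m in setT]); last exact: finite_image.
move=> p [_ hstep _ hlast].
have hex (i : 'I_L.+1) : exists m : 'I_k.+1, p`_i.+1 - p`_i == step k m.
  have [m le_mk ->] := hstep i (ltn_ord i).
  by exists (inord m); rewrite inordK.
exists [ffun i => xchoose (hex i)] => //.
apply/val_inj/(@eq_from_nth _ 0); first by rewrite /= size_map size_enum_ord size_tuple.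
move=> i; rewrite /= size_map size_enum_ord => lt_i.
rewrite (nth_map ord0) ?size_enum_ord // nth_enum_ord //.
rewrite -hlast (eq_big_nat _ _ (F2 := fun l => p`_l.+1 - p`_l)); last first.
  move=> l /andP[_ lt_l]; rewrite ffunE -(eqP (xchooseP (hex (inord l)))).
  by rewrite inordK.
by rewrite telescope_sumr // opprB addrC subrK.
Qed.

Lemma form_path s t L (p : (L.+2).-tuple weight) : paths s t L p ->
  exists j : int, form (ground s t 0 - p`_0) (Lam 1) = - j%:~R.
Proof.
move=> [_ hstep hL _].
have even i : (i <= L)%N ->
    exists j : int, (p`_(L - i)).2 = (ground s t (L - i)).2 + 2 * j.
  elim: i => [_|i IHi lt_iL]; first by exists 0; rewrite subn0 hL mulr0 addr0.
  have [j Dj] := IHi (ltnW lt_iL).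
  have [m le_m Dm] := hstep (L - i.+1)%N (leq_subr _ _).
  have := congr1 snd Dm; rewrite step_snd // weightB_snd.
  have Di : (L - i = (L - i.+1).+1)%N by lia.
  move: Dj; rewrite Di !ground_snd [odd _.+1]/= => ->.
  case: (odd _) => /= Dp; [exists (t%:Z - m%:Z + j)|exists (s%:Z - m%:Z + j)]; lia.
have [j Dj] := even L (leqnn L); exists j.
move: Dj; rewrite subnn /form weightB_snd Lam_snd => ->.
by rewrite mulr1 opprD addrA subrr add0r rmorphN rmorphM /= mulNr mulrAC mulfV ?mul1r.
Qed.

Lemma ch_supp s t L (r : rat) :
  r \in msupp (ch s t L) -> exists j : int, r = - j%:~R.
Proof.
rewrite -mcoeff_neq0 => nz; apply: contrapT => Nr.
move/eqP: nz; apply; rewrite /ch fsbig_finite /=; last exact: finite_paths.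
rewrite raddf_sum big_seq big1 // => p /=.
rewrite in_fset_set ?inE; last exact: finite_paths.
move=> /form_path[j Dj]; rewrite mcoeffU Dj; case: eqP => // Er.
by case: Nr; exists j.
Qed.

Lemma ch_expand s t L :
  ch s t L = \sum_(j \in [set: int]) << F s t L j *g (- j%:~R : rat) >>.
Proof.
pose z (r : rat) : int := - Num.floor r.
have fl (j : int) : Num.floor (- j%:~R : rat) = - j.
  by rewrite -mulrNz intrKfloor.
have zK r : r \in msupp (ch s t L) -> - (z r)%:~R = r.
  by case/ch_supp=> j ->; rewrite /z fl opprK.
rewrite {1}(monalgE (ch s t L)).
pose J := [seq z r | r <- msupp (ch s t L)].
transitivity (\sum_(j <- J) << F s t L j *g (- j%:~R : rat) >>).
  by rewrite big_map; apply: eq_big_seq => r /zK Dr; rewrite /F Dr.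
rewrite fsbig_seq; last first.
  rewrite map_inj_in_uniq ?fset_uniq // => r r' /zK Dr /zK Dr' eqz.
  by rewrite -Dr -Dr' eqz.
apply: fsbig_widen => // j [_ /= /negP jJ].
rewrite /F (_ : (ch s t L)@_(- j%:~R) = 0) ?monalgU0 //.
apply/eqP; rewrite mcoeff_eq0; apply: contra jJ => jS; apply/mapP.
by exists (- j%:~R) => //; rewrite /z fl opprK.
Qed.

Lemma sum_delta n (c : nat) (f : nat -> rat) :
  \sum_(l < n) (c == l :> nat)%:R * f l = if (c < n)%N then f c else 0.
Proof.
case: ltnP => [lt_cn|le_nc].
  rewrite (bigD1 (Ordinal lt_cn)) //= eqxx mul1r big1 ?addr0 // => l.
  by rewrite -val_eqE /= eq_sym => /negPf->; rewrite mul0r.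
rewrite big1 // => l _; case: eqP => [Ec|]; last by rewrite mul0r.
by move: (ltn_ord l); rewrite -Ec ltnNge le_nc.
Qed.

Definition cinv (k a b : nat) : rat :=
  (minn a b)%:R - (a * b)%:R / k%:R.

Lemma invmx_cartan k : (0 < k)%N ->
  invmx (cartan k) = \matrix_(i, j) cinv k i.+1 j.+1.
Proof.
move=> k_gt0; set B := (X in _ = X).
have k_neq0 : k%:R != 0 :> rat by rewrite pnatr_eq0 -lt0n.
suff CB : cartan k *m B = 1%:M.
  have [Cu _] := mulmx1_unit CB.
  by rewrite -[B]mul1mx -(mulVmx Cu) -mulmxA CB mulmx1.
apply/matrixP=> i j; rewrite !mxE.
pose f a := cinv k a j.+1.
have f0 : f 0%N = 0 by rewrite /f /cinv min0n mul0n mul0r subrr.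
have fk : f k = 0.
  rewrite /f /cinv (minn_idPr _); last by have := ltn_ord j; lia.
  by rewrite natrM mulrAC mulfV // mul1r subrr.
transitivity (2 * f i.+1 - f i - f i.+2).
  under eq_bigr => l _ do
    rewrite !mxE -/(f l.+1) !mulrBl -mulrA (eq_sym i l) -val_eqE /= eq_sym.
  rewrite !sumrB -mulr_sumr (sum_delta _ _ (fun l => f l.+1)) ltn_ord.
  rewrite (sum_delta _ _ (fun l => f l.+1)).
  congr (_ - _ - _).
    case Ei: (i : nat) => [|i'].
      by rewrite f0 big1 // => l _; rewrite mul0r.
    under eq_bigr => l _ do rewrite eqSS.
    rewrite (sum_delta _ _ (fun l => f l.+1)) ifT //.
    by have := ltn_ord i; lia.
  case: ifP => // /negbT lt_i; rewrite (_ : i.+2 = k) ?fk //.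
  by have := ltn_ord i; lia.
rewrite /f /cinv.
have -> : (i == j)%:R = (2 * minn i.+1 j.+1)%:R - (minn i j.+1)%:R
   - (minn i.+2 j.+1)%:R :> rat.
  apply/esym/eqP; rewrite !subr_eq -!natrD eqr_nat.
  by rewrite -val_eqE /=; case: eqP; lia.
by field.
Qed.

Section Integrality.

Variables (k : nat) (x : 'cV[nat]_k.-1).
Hypothesis k_gt0 : (0 < k)%N.

Lemma quad_int (r : nat) : (r <= k)%N ->
  let xv : 'cV[rat]_k.-1 := map_mx (fun n => n%:R) x in
  exists n : int,
    (xv^T *m invmx (cartan k) *m xv) 0 0
    - (xv^T *m invmx (cartan k) *m unitv k r) 0 0
    = n%:~R - (wsum x)%:R ^+ 2 / k%:R + r%:R * (wsum x)%:R / k%:R.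
Proof.
move=> le_rk xv; have k_neq0 : k%:R != 0 :> rat by rewrite pnatr_eq0 -lt0n.
pose A := (\sum_(j < k.-1) \sum_(i < k.-1) x i 0%R * minn i.+1 j.+1 * x j 0%R)%N.
pose B := (\sum_(i < k.-1) x i 0%R * minn i.+1 r)%N.
have row_ j : (xv^T *m invmx (cartan k)) 0 j =
    \sum_(i < k.-1) (x i 0)%:R * cinv k i.+1 j.+1.
  by rewrite mxE invmx_cartan //; apply: eq_bigr => i _; rewrite !mxE.
have sumc b : \sum_(i < k.-1) (x i 0)%:R * cinv k i.+1 b =
    (\sum_(i < k.-1) x i 0%R * minn i.+1 b)%:R - (wsum x)%:R * b%:R / k%:R.
  rewrite /wsum !natr_sum !mulr_suml -sumrB; apply: eq_bigr => i _.
  by rewrite /cinv !natrM; field.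
exists (A%:Z - B%:Z).
have -> : (xv^T *m invmx (cartan k) *m xv) 0 0 =
    A%:R - (wsum x)%:R ^+ 2 / k%:R.
  have AE : A%:R = \sum_(j < k.-1)
      (\sum_(i < k.-1) x i 0%R * minn i.+1 j.+1)%:R * (x j 0)%:R :> rat.
    by rewrite natr_sum; apply: eq_bigr => j _; rewrite -big_distrl natrM.
  have WE : (wsum x)%:R = \sum_(j < k.-1) j.+1%:R * (x j 0)%:R :> rat.
    by rewrite natr_sum; apply: eq_bigr => j _; rewrite natrM.
  rewrite mxE AE expr2 {2}WE mulr_sumr mulr_suml -sumrB.
  by apply: eq_bigr => j _; rewrite row_ sumc !mxE; field.
have -> : (xv^T *m invmx (cartan k) *m unitv k r) 0 0 =
    B%:R - r%:R * (wsum x)%:R / k%:R.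
  rewrite [r%:R * _]mulrC -sumc mxE.
  transitivity (\sum_(j < k.-1) (r == j.+1)%:R *
      (\sum_(i < k.-1) (x i 0)%:R * cinv k i.+1 j.+1)).
    by apply: eq_bigr => j _; rewrite row_ !mxE mulrC eq_sym.
  case: (posnP r) => [->|r_gt0].
    rewrite big1; last by move=> j _; rewrite mul0r.
    by rewrite big1 // => i _; rewrite /cinv minn0 muln0 mul0r subrr mulr0.
  pose g b := \sum_(i < k.-1) (x i 0)%:R * cinv k i.+1 b.+1.
  under eq_bigr => j _ do rewrite -{1}(prednK r_gt0) eqSS.
  rewrite (sum_delta _ _ g) /g prednK //.
  case: ltnP => // ge_r; have -> : r = k by lia.
  rewrite big1 // => i _; rewrite /cinv (minn_idPl _); last first.
    by have := ltn_ord i; lia.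
  by rewrite natrM mulfK // subrr mulr0.
by rewrite rmorphB /=; field.
Qed.

Lemma expo_int_gen (r t : nat) (j : int) : (r <= k)%N ->
    (exists n : int, r%:Z * (wsum x)%:Z + j * (j + t%:Z)
       - (wsum x)%:Z ^+ 2 = k%:Z * n) ->
  expo r t j x \is a Num.int.
Proof.
move=> le_rk [n Dn]; have k_neq0 : k%:R != 0 :> rat by rewrite pnatr_eq0 -lt0n.
rewrite /expo; have [m ->] := quad_int le_rk.
apply/intrP; exists (m + n); rewrite rmorphD /= -!addrA; congr (_ + _).
apply: (mulfI k_neq0).
move/(congr1 (fun i : int => i%:~R : rat)): Dn.
rewrite !(rmorphB, rmorphD, rmorphM, rmorphXn) /= !pmulrn => <-.
by field.
Qed.

End Integrality.

Lemma expo_int_even (s t : nat) (j n : int) (x : 'cV[nat]_(s + t).-1) :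
  (0 < s + t)%N -> (wsum x)%:Z = j + (s + t)%:Z * n ->
  expo s t j x \is a Num.int.
Proof.
move=> k_gt0 Dx; apply: expo_int_gen => //; first exact: leq_addr.
exists (j + s%:Z * n - 2 * j * n - (s + t)%:Z * n ^+ 2).
by rewrite Dx PoszD; ring.
Qed.

Lemma expo_int_odd (s t : nat) (j n : int) (x : 'cV[nat]_(s + t).-1) :
  (0 < s + t)%N -> (wsum x)%:Z = j + t%:Z + (s + t)%:Z * n ->
  expo t t j x \is a Num.int.
Proof.
move=> k_gt0 Dx; apply: expo_int_gen => //; first exact: leq_addl.
exists (t%:Z * n - 2 * (j + t%:Z) * n - (s + t)%:Z * n ^+ 2).
by rewrite Dx PoszD; ring.
Qed.

(* Main.v *)
(** A path is determined by the letters c_i = k - m_i in {0, ..., k}, and its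
    energy is, up to a constant, the sum of i * max (c_(i-1), k - c_i); the
    generating function of words therefore satisfies a recurrence in L that
    splits off the last letter.  On functions of n, let B_z be the operator
      (B_z f)(n) = sum_m z^m q^(m(m-1)) [n; m] f(m).
    The function B_z^b B_(zq)^(k-b) 1, taken at n = L, satisfies the same
    recurrence; this follows from q-commutation relations between B_(zq),
    B_(zq^2), the shift in n and multiplication by q^n.  Expanding the operator
    word gives a sum over chains L >= M_1 >= ... >= M_k whose terms are the
    q-multinomial coefficients in x_l = M_l - M_(l+1), with exponent
    sum_l M_l^2 - (M_1 + ... + M_b); as (C^(-1))_(ij) = min (i, j) - ij/k, this is
    the quadratic form of the theorem up to a correction depending only on j. *)

Require Import Defs.
From HB Require Import structures.
From mathcomp Require Import all_boot all_order all_algebra fraction archimedean.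
From mathcomp Require Import ring zify.
From mathcomp Require Import boolp functions classical_sets fsbigop.
From mathcomp Require Import monalg.

Import Order.TTheory GRing.Theory Num.Theory.
Local Open Scope classical_set_scope.
Local Open Scope ring_scope.

(** * q-binomial coefficients *)

Section QBinomial.

Variables (R : comNzRingType) (q : R).

(** The Pascal rule needs no division, so the definition makes sense over any commutative ring;
    below it is used over polynomials in z. *)
Fixpoint qbinom (n m : nat) : R :=
  match n, m with
  | _, 0 => 1
  | 0, _.+1 => 0
  | n'.+1, m'.+1 => qbinom n' m' + q ^+ m * qbinom n' m
  end.

Lemma qbinom0 n : qbinom n 0 = 1.
Proof. by case: n. Qed.

Lemma qbinomS n m :
  qbinom n.+1 m.+1 = qbinom n m + q ^+ m.+1 * qbinom n m.+1.
Proof. by []. Qed.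

Lemma qbinom_small n m : (n < m)%N -> qbinom n m = 0.
Proof.
elim: n m => [|n IHn] [|m] // lt_nm.
by rewrite qbinomS !IHn ?mulr0 ?addr0 // ltnW.
Qed.

(** By the Pascal rule, the claim for n at m and at m + 1 yields it for n + 1 at m + 1. The
    truncated n - m is harmless: for m >= n both sides are 0. *)
Lemma mul_qbinom_down n m :
  (1 - q ^+ m.+1) * qbinom n m.+1 = (1 - q ^+ (n - m)) * qbinom n m.
Proof.
elim: n m => [|n IHn] m; first by rewrite mulr0 sub0n subrr mul0r.
rewrite qbinomS; case: m => [|m].
  have := IHn 0; rewrite subn0 !qbinom0 mulr1 mulrDr [X in _ + X = _]mulrCA => ->.
  by rewrite subn0 (exprS q n); ring.
rewrite subSS qbinomS.
have [le_mn|lt_nm] := leqP m n; last first.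
  by rewrite !qbinom_small ?(mulr0, addr0) // !ltnS ltnW // ltnW.
have := IHn m.+1; have := IHn m.
have [e|lt_mn] : m = n \/ (m < n)%N by lia.
  rewrite {}e ?subSS subnn (qbinom_small n n.+1) // (qbinom_small n n.+2) //.
  by rewrite !(mulr0, addr0) subrr mul0r.
rewrite (_ : n - m = (n - m.+1).+1)%N; last by lia.
set a := qbinom n m; set b := qbinom n m.+1; set c := qbinom n m.+2 => h1 h2.
rewrite (exprS _ m.+1) in h2 *.
rewrite mulrDr [X in _ + X = _]mulrCA h2 mulrDr -h1 (exprS _ (n - m.+1)); ring.
Qed.

Lemma mul_qbinom_diag n m :
  (1 - q ^+ m.+1) * qbinom n.+1 m.+1 = (1 - q ^+ n.+1) * qbinom n m.
Proof.
rewrite qbinomS mulrDr mulrCA mul_qbinom_down.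
have [le_mn|lt_nm] := leqP m n; last by rewrite qbinom_small // !mulr0 addr0.
have -> : q ^+ n.+1 = q ^+ (n - m) * q ^+ m.+1 by rewrite -exprD addnS subnK.
ring.
Qed.

Lemma qbinomS_dual n m :
  qbinom n.+1 m.+1 = qbinom n m.+1 + q ^+ (n - m) * qbinom n m.
Proof.
rewrite qbinomS; have h := mul_qbinom_down n m.
transitivity (qbinom n m + (qbinom n m.+1 - (1 - q ^+ m.+1) * qbinom n m.+1)).
  ring.
by rewrite h; ring.
Qed.

End QBinomial.

Arguments qbinom {R} q n m : simpl never.

(** * The operators B_z, the shift and multiplication by powers of q *)

Section Operators.

Variables (R : comNzRingType) (q : R).
Implicit Types (z : R) (f g : nat -> R).

Definition qop z f (n : nat) : R :=
  \sum_(m < n.+1) z ^+ m * q ^+ (m * m.-1) * qbinom q n m * f m.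

Definition shiftop f (n : nat) : R := f n.+1.

(** The exponent n + 1 is the one that the Pascal rule produces in [shift_qop]. *)
Definition scaleop z f (n : nat) : R := z * q ^+ n.+1 * f n.

(** The q-binomials beyond n vanish; the double sums of [qop_comm] need a common range of
    summation. *)
Lemma qopE N z f n : (n <= N)%N ->
  qop z f n = \sum_(m < N.+1) z ^+ m * q ^+ (m * m.-1) * qbinom q n m * f m.
Proof.
move=> le_nN; rewrite /qop.
rewrite -!(big_mkord xpredT (fun m => z ^+ m * q ^+ (m * m.-1) * qbinom q n m * f m)).
rewrite [RHS](big_cat_nat (n := n.+1)) //=.
rewrite [X in _ + X]big_nat_cond [X in _ + X]big1 ?addr0 // => m /andP[/andP[h _] _].
by rewrite qbinom_small ?mulr0 ?mul0r.
Qed.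

Lemma qopD z f g : qop z (f + g) = qop z f + qop z g.
Proof.
apply/funext => n; rewrite !fctE /qop -big_split.
by apply: eq_bigr => m _; rewrite /= mulrDr.
Qed.

Lemma qopB z f g : qop z (f - g) = qop z f - qop z g.
Proof.
apply/funext => n; rewrite !fctE /qop -sumrB.
by apply: eq_bigr => m _; rewrite /= mulrBr.
Qed.

Lemma qop_scale z f c : qop z (fun m => c * f m) = fun n => c * qop z f n.
Proof.
apply/funext => n; rewrite /qop mulr_sumr; apply: eq_bigr => m _; ring.
Qed.

Lemma qopMq z f : qop z (fun m => q ^+ m * f m) = qop (z * q) f.
Proof.
apply/funext => n; rewrite /qop; apply: eq_bigr => m _.
rewrite exprMn; ring.
Qed.


(** The dual Pascal rule splits [n+1; m+1]. In the second part m(m+1) = m(m-1) + 2m, and the powers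
    regroup as z q^(n+1) times (z q^2)^m q^(m(m-1)). *)
Lemma shift_qop z f :
  shiftop (qop (z * q) f)
  = qop (z * q) f + scaleop z (qop (z * q * q) (shiftop f)).
Proof.
apply/funext => n; rewrite !fctE /shiftop /scaleop.
rewrite (qopE n.+1 (z * q) f n) // /qop big_ord_recl [in RHS]big_ord_recl.
rewrite !qbinom0 /= -addrA; congr (_ + _).
rewrite mulr_sumr -big_split /=; apply: eq_bigr => m _.
rewrite /bump /= add1n add0n qbinomS_dual mulrDr mulrDl; congr (_ + _).
rewrite (_ : m.+1 * m = m * m.-1 + m + m)%N; last by case: (m : nat) => //=; lia.
have -> : q ^+ n.+1 = q ^+ (n - m) * q ^+ m.+1.
  by rewrite -exprD addnS subnK // -ltnS.
rewrite !exprD !exprMn !exprS; ring.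
Qed.

(* Comparing the coefficients of f(l), the terms with inner index m on the left
   match those with inner index m - 1 on the right. *)
Lemma qop_comm z f :
  qop (z * q * q) (qop (z * q) f) - qop (z * q) (qop (z * q * q) f)
  = scaleop z (qop (z * q * q) (qop (z * q * q) f))
    - qop (z * q * q) (scaleop z (qop (z * q * q) f)).
Proof.
apply/funext => n; rewrite !fctE /scaleop.
pose c m l := (z * q) ^+ (m + l) * q ^+ (m * m.-1 + l * l.-1)
              * (qbinom q n m * qbinom q m l) * f l.
have dbl (y1 y2 : R) g : g =1 (fun m => qop y2 f m) ->
    qop y1 g n = \sum_(m < n.+1) \sum_(l < n.+1) y1 ^+ m * q ^+ (m * m.-1)
         * qbinom q n m * (y2 ^+ l * q ^+ (l * l.-1) * qbinom q m l * f l).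
  move=> eg; rewrite /qop; apply: eq_bigr => m _; rewrite eg (qopE n) -1?ltnS //.
  by rewrite mulr_sumr.
rewrite !(dbl _ _ _ (frefl _)) -sumrB.
transitivity (\sum_(m < n.+1) \sum_(l < n.+1) c m l * (q ^+ m - q ^+ l)).
  apply: eq_bigr => m _; rewrite -sumrB; apply: eq_bigr => l _.
  by rewrite /c !exprD !exprMn; ring.
transitivity (\sum_(m < n.+1) \sum_(l < n.+1)
    c m l * z * q ^+ (m + l).+1 * (q ^+ n - q ^+ m)); last first.
  rewrite [X in _ = _ - X]/qop mulr_sumr -sumrB; apply: eq_bigr => m _.
  rewrite (qopE n) -1?ltnS // !mulr_sumr -sumrB; apply: eq_bigr => l _.
  rewrite /c !exprS !exprD !exprMn; ring.
rewrite big_ord_recl [RHS]big_ord_recr /=.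
rewrite [X in _ = _ + X]big1 ?addr0; last by move=> l _; rewrite subrr mulr0.
rewrite big1 ?add0r; last first.
  move=> [[|l] lt_l] _ /=; first by rewrite subrr mulr0.
  by rewrite /c [qbinom q 0 _]qbinom_small // !(mulr0, mul0r).
apply: eq_bigr => m _; apply: eq_bigr => l _.
rewrite /bump /= add1n.
have lt_mn : (m < n)%N by [].
(* For m < l both sides vanish: the right by a q-binomial, the left by the difference of powers if l
   = m + 1 and by a q-binomial otherwise. *)
have [lt_ml|le_lm] := ltnP m l.
  rewrite {2}/c (qbinom_small _ _ m l) // !(mulr0, mul0r).
  have [->|ne] := eqVneq (l : nat) m.+1; first by rewrite subrr mulr0.
  rewrite /c (qbinom_small _ _ m.+1 l) ?(mulr0, mul0r) //; lia.
have h1 := mul_qbinom_down _ q n m.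
have h2 : (1 - q ^+ (m.+1 - l)) * qbinom q m.+1 l = (1 - q ^+ m.+1) * qbinom q m l.
  by case: (l : nat) le_lm => [|l'] h;
    rewrite ?subn0 ?qbinom0 // -mul_qbinom_down mul_qbinom_diag.
rewrite {1}/c.
have -> : q ^+ m.+1 - q ^+ l = - q ^+ l * (1 - q ^+ (m.+1 - l)).
  by rewrite mulrBr mulr1 mulNr -exprD subnKC ?leqW //; ring.
transitivity (- q ^+ l * (z * q) ^+ (m.+1 + l) * q ^+ (m.+1 * m + l * l.-1)
    * qbinom q n m.+1 * ((1 - q ^+ (m.+1 - l)) * qbinom q m.+1 l) * f l).
  rewrite /=; ring.
rewrite h2.
transitivity (- q ^+ l * (z * q) ^+ (m.+1 + l) * q ^+ (m.+1 * m + l * l.-1)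
    * qbinom q m l * ((1 - q ^+ m.+1) * qbinom q n m.+1) * f l); first by ring.
rewrite h1 /c.
rewrite (_ : m.+1 * m = m * m.-1 + m + m)%N; last by case: (m : nat) => //=; lia.
have -> : q ^+ n = q ^+ (n - m) * q ^+ m by rewrite -exprD subnK // ltnW.
rewrite addSn !exprS !exprD !exprMn; ring.
Qed.

End Operators.

Arguments qop {R} q z f n.
Arguments shiftop {R} f n.
Arguments scaleop {R} q z f n.

(** * Recurrence for operator words *)

Section OperatorWords.

Variables (R : comNzRingType) (q z : R).
Implicit Types (f g : nat -> R) (b m : nat).

Let T := qop q (z * q).
Let U := qop q (z * q * q).
Let Z := scaleop q z.
Let E := @shiftop R.

Lemma iter_qopD w b f g :
  iter b (qop q w) (f + g) = iter b (qop q w) f + iter b (qop q w) g.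
Proof. by elim: b => //= b ->; rewrite qopD. Qed.

Lemma iter_qopB w b f g :
  iter b (qop q w) (f - g) = iter b (qop q w) f - iter b (qop q w) g.
Proof. by elim: b => //= b ->; rewrite qopB. Qed.

Lemma iter_qop_scale w b f c :
  iter b (qop q w) (fun m => c * f m) = fun n => c * iter b (qop q w) f n.
Proof. by elim: b => //= b ->; rewrite qop_scale. Qed.

Lemma qop_scaleop f : T (Z f) = fun n => z * q * U f n.
Proof.
rewrite /U -qopMq -qop_scale; congr qop; apply/funext => m.
by rewrite /Z /scaleop exprS; ring.
Qed.

(** The commutators telescope: in the induction the two terms [U (Z (iter b.+1 U f))], one from the
    hypothesis and one from [qop_comm], cancel. *)
Lemma iter_qop_comm b f :
  iter b U (T f) - T (iter b U f) = Z (iter b.+1 U f) - iter b U (Z (U f)).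
Proof.
elim: b => [|b IHb]; first by rewrite /= !subrr.
have -> : iter b.+1 U (T f) =
    U (T (iter b U f)) + (U (Z (iter b.+1 U f)) - iter b.+1 U (Z (U f))).
  by rewrite /= -qopB -qopD -IHb addrC subrK.
rewrite addrAC qop_comm /= addrA; congr (_ - _).
by rewrite subrK.
Qed.

(** Induction on m. [shift_qop] moves the shift past one [T], and [iter_qop_comm] moves that [T]
    past the powers of [U]. The extra terms cancel, except for two that by [qop_scaleop] both equal
    zq U^(b+2) E T^m 1. *)
Lemma iter_shift_qop b m :
  iter b U (E (iter m.+1 T (fun=> 1))) - Z (iter b.+1 U (E (iter m T (fun=> 1))))
  = iter m.+1 T (iter b U (fun=> 1)).
Proof.
elim: m => [|m IHm].
  rewrite [iter 1 _ _]/= /E shift_qop iter_qopD -/Z -/T -/U.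
  have -> : shiftop (fun=> 1) = (fun=> 1) :> (nat -> R) by [].
  have := iter_qop_comm b (fun=> 1).
  move/eqP; rewrite subr_eq => /eqP ->.
  by apply/funext => n; rewrite /= !fctE; ring.
rewrite (iterS m.+1 T (iter b U _)) -IHm.
set f := iter m T (fun=> 1).
have ET h : E (T h) = T h + Z (U (E h)) by rewrite /E shift_qop.
pose e := E (T f); pose a := Z (U (E f)).
have Te : T f = e - a by rewrite /e ET addrK.
have C : iter b U (T e) = T (iter b U e) + Z (U (iter b U e)) - iter b U (Z (U e)).
  by rewrite -addrA -iterS -iter_qop_comm addrC subrK.
rewrite [iter m.+2 _ _]/= [iter m.+1 _ _]/= -/f ET -/e.
have TB h1 h2 : T (h1 - h2) = T h1 - T h2 by rewrite /T qopB.
rewrite {1}Te !iterS TB /U iter_qopD iter_qopB -/U C.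
rewrite [in RHS]TB [X in X - _]addrAC subrK addrAC addrK; congr (_ - _).
by rewrite /a !qop_scaleop /U iter_qop_scale -/U -iterS -!iterSr.
Qed.

(** Iteration of [iter_shift_qop]: each application trades a [T] for a [U] at the price of a factor
    z q^(n+1). *)
Lemma iter_shift b m n :
  iter b U (E (iter m T (fun=> 1))) n
  = \sum_(c < m.+1)
      (z * q ^+ n.+1) ^+ c * iter (m - c) T (iter (b + c) U (fun=> 1)) n.
Proof.
elim: m b => [|m IHm] b.
  by rewrite big_ord1 expr0 mul1r addn0.
have /(congr1 (fun f => f n)) := iter_shift_qop b m.
rewrite !fctE => /eqP; rewrite subr_eq => /eqP ->.
rewrite /Z /scaleop IHm [in RHS]big_ord_recl expr0 mul1r subn0 addn0 mulr_sumr.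
congr (_ + _); apply: eq_bigr => c _.
by rewrite !lift0 subSS addSnnS mulrA -exprS.
Qed.

Let Y := qop q z.
(** At n = 0 the factor 1 - q^n is zero, so no value of f at -1 is called for. *)
Let V f (n : nat) : R := if n is n'.+1 then z * (1 - q ^+ n) * f n' else 0.

(** The subtraction leaves a factor 1 - q^m, which [mul_qbinom_diag] turns into 1 - q^n while
    lowering both indices. *)
Lemma qop_twist f : Y f - T f = V (U (E f)).
Proof.
apply/funext => -[|n]; rewrite !fctE /V.
  by rewrite /Y /T /qop !big_ord1 /= !expr0 subrr.
rewrite /Y /T /qop -sumrB big_ord_recl /= !expr0 subrr add0r mulr_sumr.
apply: eq_bigr => m _; rewrite ?lift0 /bump ?leq0n ?add1n ?add0n /=.
rewrite (_ : m.+1 * m = m * m.-1 + m + m)%N; last by case: (m : nat) => //=; lia.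
transitivity (z ^+ m.+1 * q ^+ (m * m.-1 + m + m)
              * ((1 - q ^+ m.+1) * qbinom q n.+1 m.+1) * f m.+1).
  by rewrite exprMn; ring.
rewrite mul_qbinom_diag /E /shiftop !exprD !exprMn !exprS; ring.
Qed.

Lemma qop_V f : Y (V f) = fun n => z * V (U f) n.
Proof.
apply/funext => -[|n]; rewrite /Y /qop.
  by rewrite big_ord1 /V !mulr0.
rewrite big_ord_recl [V f _]/= mulr0 add0r [V _ n.+1]/= /U /qop !mulr_sumr.
apply: eq_bigr => m _; rewrite ?lift0 /bump ?leq0n ?add1n ?add0n /=.
rewrite (_ : m.+1 * m = m * m.-1 + m + m)%N; last by case: (m : nat) => //=; lia.
transitivity (z ^+ m.+1 * q ^+ (m * m.-1 + m + m)
              * ((1 - q ^+ m.+1) * qbinom q n.+1 m.+1) * (z * f m)).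
  by ring.
rewrite mul_qbinom_diag !exprD !exprMn !exprS; ring.
Qed.

Lemma iter_qop_V b f : iter b Y (V f) = fun n => z ^+ b * V (iter b U f) n.
Proof.
elim: b f => [|b IHb] f; first by apply/funext => n; rewrite expr0 mul1r.
rewrite iterSr qop_V /Y iter_qop_scale -/Y IHb -iterSr.
by apply/funext => n; rewrite mulrA -exprS.
Qed.

Definition qword b m := iter b (qop q z) (iter m (qop q (z * q)) (fun=> 1)).

(** Induction on b, starting from [iter_shift]. Changing one B_(zq) into B_z adds a term with factor
    1 - q^(n+1); it lowers the exponent (n+1)(c-b) to (n+1)(c-b-1) for c > b and leaves c <= b
    alone. The truncated c - b is max (c, b) - b, which will match the maximum in the energy. *)
Lemma qwordS k b n : (b <= k)%N ->
  qword b (k - b) n.+1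
  = \sum_(c < k.+1) z ^+ c * q ^+ (n.+1 * (c - b))
                    * iter (k - c) T (iter c U (fun=> 1)) n.
Proof.
elim: b => [_|b IHb lt_bk].
  rewrite subn0 /qword [iter 0 _ _]/= -/T.
  rewrite (iter_shift 0 k n : iter k T (fun=> 1) n.+1 = _).
  by apply: eq_bigr => c _; rewrite subn0 add0n exprMn -exprM.
have -> : qword b.+1 (k - b.+1) n.+1 = qword b (k - b) n.+1
    + z ^+ b * V (iter b U (U (E (iter (k - b.+1) T (fun=> 1))))) n.+1.
  have -> : (k - b = (k - b.+1).+1)%N by lia.
  set f := iter (k - b.+1) T (fun=> 1).
  have /(congr1 (fun f => f n.+1)) := iter_qop_V b (U (E f)).
  rewrite /= -qop_twist {1}/Y iter_qopB fctE => <-.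
  by rewrite addrC -iterSr /qword /= -/T -/f addrA addrN add0r.
rewrite (IHb (ltnW lt_bk)) [V _ _]/= -iterSr iter_shift.
pose G c := iter (k - c) T (iter c U (fun=> 1)) n.
have split a : \sum_(c < k.+1) z ^+ c * q ^+ (n.+1 * (c - a)) * G c
    = \sum_(c < b.+1) z ^+ c * q ^+ (n.+1 * (c - a)) * G c
    + \sum_(c < k - b) z ^+ (c + b.+1) * q ^+ (n.+1 * (c + b.+1 - a))
                       * G (c + b.+1)%N.
  rewrite -!(big_mkord xpredT (fun c => z ^+ c * q ^+ (n.+1 * (c - a)) * G c)).
  rewrite (big_cat_nat (n := b.+1)) ?ltnS //=; last exact: ltnW.
  by rewrite -[X in index_iota X k.+1]add0n big_addn subSS !big_mkord.
rewrite !split -addrA; congr (_ + _).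
  apply: eq_bigr => c _; have le_cb : (c <= b)%N by rewrite -ltnS.
  by rewrite (eqP le_cb) (eqP (leqW le_cb : c <= b.+1)%N).
rewrite (_ : (k - b.+1).+1 = k - b)%N; last by lia.
rewrite !mulr_sumr -big_split; apply: eq_bigr => c _.
rewrite -[LHS]/(_ + _).
rewrite addnK (_ : c + b.+1 - b = c.+1)%N; last by lia.
rewrite (_ : k - b.+1 - c = k - (c + b.+1))%N; last by lia.
rewrite [(b.+1 + c)%N]addnC -/(G (c + b.+1)%N).
rewrite (mulnS n.+1 c) !(exprD z, exprD q n.+1) exprMn -exprM [z ^+ b.+1]exprS.
ring.
Qed.

End OperatorWords.

Arguments qword {R} q z b m n.

(** * Operator words as sums over compositions *)

Fixpoint compositions (k n : nat) : seq (seq nat) :=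
  if k is k'.+1 then
    [seq (n - m)%N :: y | m <- iota 0 n.+1, y <- compositions k' m]
  else [:: [:: n]].

Arguments compositions k n : simpl never.

Lemma compositionsS k n : compositions k.+1 n =
  [seq (n - m)%N :: y | m <- iota 0 n.+1, y <- compositions k m].
Proof. by []. Qed.

Lemma mem_compositions k n x :
  (x \in compositions k n) = (size x == k.+1) && (sumn x == n).
Proof.
elim: k n x => [|k IHk] n [|a x]; rewrite ?inE ?compositionsS.
- by [].
- rewrite eqseq_cons; case: x => [|b x] //=; last by rewrite andbF.
  by rewrite addn0 andbT.
- by apply/allpairsPdep => -[m [y [_ _ ]]].
apply/allpairsPdep/andP => [[m [y [+ + [-> ->]]]]|[]].
  rewrite mem_iota IHk => /andP[_ lt_mn] /andP[/eqP sz /eqP Dm].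
  by rewrite /= sz Dm eqxx; split=> //; apply/eqP; lia.
rewrite eqSS => /eqP sz /eqP /= Dn; exists (sumn x), x; split.
- by rewrite -[X in _ \in X]/(iota 0 n.+1) mem_iota; lia.
- by rewrite IHk eqxx andbT; apply/eqP.
- by rewrite -Dn addnK.
Qed.

Lemma big_compositions (V : nmodType) k n (f : seq nat -> V) :
  \sum_(x <- compositions k.+1 n) f x
  = \sum_(i < n.+1) \sum_(y <- compositions k i) f ((n - i)%N :: y).
Proof.
by rewrite compositionsS big_allpairs_dep -(big_mkord xpredT
  (fun i => \sum_(y <- compositions k i) f ((n - i)%N :: y))) /index_iota subn0.
Qed.

Lemma uniq_compositions k n : uniq (compositions k n).
Proof.
elim: k n => [|k IHk] n //; rewrite compositionsS.
apply: allpairs_uniq_dep; rewrite ?iota_uniq // => -[m x] [m' x'].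
move=> /allpairsPdep[m1 [x1 [_ h1 [-> ->]]]].
move=> /allpairsPdep[m2 [x2 [_ h2 [-> ->]]]] /= [_ Dx].
move: h1 h2; rewrite !mem_compositions -Dx => /andP[_ /eqP<-] /andP[_ /eqP<-].
by [].
Qed.

(* With M_l = x_l + x_(l+1) + ... these are sum_(l >= 1) M_l and
   sum_(l >= 1) M_l ^ 2 - sum_(1 <= l <= b) M_l. *)
Fixpoint weightsum (x : seq nat) : nat :=
  if x is _ :: y then sumn y + weightsum y else 0.

Fixpoint sqexp (b : nat) (x : seq nat) : nat :=
  if x is _ :: y then
    if b is b'.+1 then sumn y * (sumn y).-1 + sqexp b' y
    else sumn y * sumn y + sqexp 0 y
  else 0.

Section CompositionSum.

Variable R : comNzRingType.
Implicit Types q z : R.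

(** A product of the q-binomials [M_l; M_(l+1)] replaces the quotient of q-factorials, so that it
    lives over polynomials in z; see [qchain_qfact]. *)
Fixpoint qchain q (x : seq nat) : R :=
  if x is _ :: y then qbinom q (sumn x) (sumn y) * qchain q y else 1.

(** The tail sum i of a composition is the summation index of the outermost operator. B_z
    contributes z^i q^(i(i-1)) and B_(zq) contributes z^i q^(i^2): the two branches of [sqexp]. *)
Lemma qword_sum q z b m n :
  qword q z b m n
  = \sum_(x <- compositions (b + m) n)
      z ^+ weightsum x * q ^+ sqexp b x * qchain q x.
Proof.
elim: b n => [|b IHb] n.
  elim: m n => [|m IHm] n.
    rewrite -[LHS]/1 -[compositions _ n]/[:: [:: n]] big_seq1 /=.
    by rewrite !addn0 !expr0 qbinom0 !mulr1.
  rewrite add0n big_compositions -[LHS]/(qop q (z * q) (qword q z 0 m) n).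
  apply: eq_bigr => i _; rewrite IHm add0n mulr_sumr; apply: eq_big_seq => y.
  rewrite mem_compositions => /andP[_ /eqP Dy].
  rewrite /= Dy subnK -1?ltnS //.
  rewrite (_ : i * i = i + i * i.-1)%N; last first.
    by case: (i : nat) => //= ?; rewrite mulnS; lia.
  rewrite !exprD exprMn; ring.
rewrite addSn big_compositions -[LHS]/(qop q z (qword q z b m) n).
apply: eq_bigr => i _; rewrite IHb mulr_sumr; apply: eq_big_seq => y.
rewrite mem_compositions => /andP[_ /eqP Dy].
rewrite /= Dy subnK -1?ltnS // !exprD; ring.
Qed.

End CompositionSum.

(** * Generating function of words *)

Section Recurrence.

Variables (K : fieldType) (q : K).

Lemma qbinom_polyC n m : qbinom q%:P n m = (qbinom q n m)%:P.
Proof.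
elim: n m => [|n IHn] [|m] //.
by rewrite !qbinomS !IHn polyCD polyCM polyC_exp.
Qed.

Lemma qchain_polyC x : qchain _ q%:P x = (qchain _ q x)%:P.
Proof. by elim: x => //= a x ->; rewrite qbinom_polyC polyCM. Qed.

(* The coefficient of z^A in the operator word. *)
Definition compsum (k n b A : nat) : K :=
  \sum_(x <- compositions k n | weightsum x == A) q ^+ sqexp b x * qchain _ q x.

(** The constant c is carried along because the recurrence replaces z by zq. *)
Lemma coef_qword c b m n A :
  (qword q%:P ('X * c%:P) b m n)`_A = c ^+ A * compsum (b + m) n b A.
Proof.
rewrite qword_sum coef_sum /compsum mulr_sumr [RHS]big_mkcond.
apply: eq_bigr => x _.
rewrite qchain_polyC -!polyC_exp exprMn -polyC_exp -!mulrA -!polyCM coefXnM.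
rewrite coefC; case: ltngtP => h.
- by [].
- by rewrite subn_eq0 leqNgt h.
- by rewrite h subnn eqxx -h.
Qed.

(** The inner word of [qwordS] is [qword] at zq, whose coefficient at A - c acquires the factor q^(A
    - c). *)
Lemma compsumS k n b A : (b <= k)%N ->
  compsum k n.+1 b A
  = \sum_(c < k.+1 | (c <= A)%N)
      q ^+ (n.+1 * (c - b)) * (q ^+ (A - c) * compsum k n (k - c) (A - c)).
Proof.
move=> le_bk.
have := congr1 (fun p : {poly K} => p`_A) (qwordS _ q%:P ('X * 1%:P) k b n le_bk).
rewrite coef_qword expr1n mul1r subnKC // => ->.
rewrite coef_sum [RHS]big_mkcond; apply: eq_bigr => c _.
have le_ck : (c <= k)%N by rewrite -ltnS.
rewrite -[iter _ _ _ _]/(qword q%:P ('X * 1%:P * q%:P) (k - c) c n).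
rewrite mulr1 -polyC_exp -mulrA coefXnM; case: ltnP => // le_cA.
by rewrite coefCM coef_qword subnK.
Qed.

Lemma compsum0 k b A : (b <= k)%N -> compsum k 0 b A = (A == 0)%:R.
Proof.
move=> le_bk; have := coef_qword 1 b (k - b) 0 A.
rewrite expr1n mul1r subnKC // => <-.
have qop0 z f : qop q%:P z f 0 = f 0.
  by rewrite /qop big_ord1 qbinom0 !expr0 !mul1r.
have -> : qword q%:P ('X * 1%:P) b (k - b) 0 = 1.
  by rewrite /qword; elim: b {le_bk} (k - b)%N => [|b IHb] m /=;
    rewrite ?qop0 //; elim: m => //= m IHm; rewrite qop0.
by rewrite coef1.
Qed.

Fixpoint words (k L : nat) : seq (seq nat) :=
  if L is L'.+1 then [seq c :: w | c <- iota 0 k.+1, w <- words k L']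
  else [:: [::]].

(* The letters of a word are listed from the last, c_(L-1), to the first, c_0;
   b plays the role of m_L. *)
Fixpoint wordexp (k b : nat) (w : seq nat) : nat :=
  if w is c :: w' then size w * maxn c b + wordexp k (k - c) w' else 0.

Arguments words k L : simpl never.

Lemma wordsS k L : words k L.+1 = [seq c :: w | c <- iota 0 k.+1, w <- words k L].
Proof. by []. Qed.

Lemma mem_words k L w :
  (w \in words k L) = (size w == L) && all (fun c => (c <= k)%N) w.
Proof.
elim: L w => [|L IHL] [|c w] //; rewrite wordsS.
  by apply/allpairsPdep => -[m [y [_ _ ]]].
apply/allpairsPdep/idP => [[c1 [w1 [+ + [-> ->]]]]|].
  by rewrite mem_iota IHL /= eqSS add0n ltnS => -> /andP[-> ->].
rewrite /= eqSS => /and3P[sz le_ck le_wk]; exists c, w.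
by rewrite -[X in _ \in X]/(iota 0 k.+1) mem_iota IHL; split=> //; apply/andP.
Qed.

Lemma uniq_words k L : uniq (words k L).
Proof.
elim: L => [|L IHL] //; rewrite wordsS.
by apply: allpairs_uniq => //; [exact: iota_uniq | move=> [? ?] [? ?] _ _ [-> ->]].
Qed.

(** Induction on L: removing the last letter c replaces b by k - c, and on the right this is
    [compsumS]. The factor q^(L * A) avoids negative exponents. *)
Lemma wordsum k L b A : (b <= k)%N ->
  q ^+ (L * A) * \sum_(w <- words k L | sumn w == A) q ^+ wordexp k b w
  = q ^+ (b * L + k * 'C(L, 2) + A) * compsum k L b A.
Proof.
elim: L b A => [|L IHL] b A le_bk.
  rewrite compsum0 // /words big_cons big_nil eq_sym.
  by case: eqP => [->|_]; rewrite ?mulr0 // addr0 !muln0.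
rewrite compsumS // wordsS big_mkcond big_allpairs_dep.
have -> : iota 0 k.+1 = index_iota 0 k.+1 by rewrite /index_iota subn0.
rewrite big_mkord !mulr_sumr [RHS]big_mkcond.
apply: eq_bigr => c _; rewrite -big_mkcond /=.
case: leqP => [le_cA|lt_Ac]; last first.
  by rewrite big1_seq ?mulr0 // => w /andP[/eqP e _]; lia.
have le_ck : (c <= k)%N by rewrite -ltnS.
transitivity (q ^+ (L.+1 * maxn c b + L.+1 * c + (A - c))
   * (q ^+ (L * (A - c)) * \sum_(w <- words k L | sumn w == (A - c)%N)
         q ^+ wordexp k (k - c) w)).
  rewrite mulrA -exprD.
  have -> : (L.+1 * maxn c b + L.+1 * c + (A - c) + L * (A - c)
             = L.+1 * A + L.+1 * maxn c b)%N.
    by move: (subnKC le_cA); move: (A - c)%N => d <-; rewrite !mulSn; ring.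
  rewrite exprD -mulrA; congr (_ * _).
  rewrite mulr_sumr big_seq_cond [RHS]big_seq_cond.
  apply: eq_big => [w|w /andP[]].
    by congr (_ && _); rewrite -(eqn_add2l c (sumn w)) subnKC.
  by rewrite mem_words => /andP[/eqP-> _] _; rewrite exprD.
rewrite IHL ?leq_subr // mulrA -exprD [RHS]mulrA -exprD mulrA -exprD.
congr (q ^+ _ * _).
(* Here max (c, b) = b + (c - b) meets the truncated difference of [compsumS]. *)
rewrite binS bin1 maxnC maxnE.
move: (subnKC le_cA) (subnKC le_ck).
move: (nat_of_ord c) (c - b)%N (A - c)%N (k - c)%N ('C(L, 2)) => d x y v C <- <-.
by rewrite !mulSn !mulnS; ring.
Qed.

End Recurrence.

(** * Correspondence of paths and words *)

Definition level (a : int * int) : int := a.1 + a.2.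

Fact level_is_additive : zmod_morphism level.
Proof. by move=> a b; rewrite /level /= addrACA opprD. Qed.

HB.instance Definition _ :=
  GRing.isZmodMorphism.Build (int * int)%type int level level_is_additive.

Section PathsAsWords.

Variables (s t : nat).
Let k := (s + t)%N.

(* The number m_i of the ground-state path. *)
Definition gmu (i : nat) : nat := if odd i then t else s.

Lemma gmu_le i : (gmu i <= k)%N.
Proof. by rewrite /gmu /k; case: odd; rewrite ?leq_addl ?leq_addr. Qed.

Lemma gmuS i : gmu i.+1 = (k - gmu i)%N.
Proof. by rewrite /gmu /k /=; case: odd; rewrite /= ?addKn ?addnK. Qed.

Lemma ground_step i : ground s t i.+1 - ground s t i = step k (gmu i).
Proof.
rewrite /step -gmuS /ground /hat0 /hat1 /gmu.
have odd_Lam n : Lam n = Lam (odd n) by rewrite /Lam; case: (odd n).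
rewrite (odd_Lam i) (odd_Lam i.+1) (odd_Lam i.+2) /= negbK.
by case: odd; rewrite /= !mulrnBl opprD addrACA // addrC.
Qed.

Lemma level_ground i : level (ground s t i) = k%:Z.
Proof.
rewrite /ground raddfD !raddfMn /= /level /Lam /=.
by case: odd; rewrite /= /k; lia.
Qed.

Lemma level_step m : level (step k m) = 0.
Proof.
transitivity ((0 : int) *+ m + (0 : int) *+ (k - m)); last by rewrite !mul0rn.
by rewrite /step raddfD !raddfMn.
Qed.

Lemma step_inj m1 m2 : (m1 <= k)%N -> (m2 <= k)%N -> step k m1 = step k m2 -> m1 = m2.
Proof. by move=> le1 le2 /(congr1 snd); rewrite !step_snd //; lia. Qed.

Lemma mu_step p i m : (m <= k)%N -> p`_i.+1 - p`_i = step k m -> mu k p i = m.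
Proof.
move=> le_mk Dp; rewrite /mu; case: pickP => [m' /eqP|].
  by rewrite Dp => /step_inj -> //; rewrite -ltnS.
by move/(_ (Ordinal (le_mk : m < k.+1)%N)); rewrite Dp eqxx.
Qed.

Variable L : nat.
Implicit Types w : seq nat.

(** Letters are stored from the last to the first, hence the position [L.-1 - l]. The number m_L is
    not a letter, since p_L and p_(L+1) are prescribed. *)
Definition word_mu w (l : nat) : nat :=
  if l == L then gmu L else (k - nth 0 w (L.-1 - l))%N.

(** The path is built backwards because its end is the prescribed part. *)
Definition word_path w : (L.+2).-tuple weight :=
  [tuple ground s t L.+1 - \sum_(i <= l < L.+1) step k (word_mu w l) | i < L.+2].

Definition path_word (p : seq weight) : seq nat :=
  [seq (k - mu k p (L.-1 - i))%N | i <- iota 0 L].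

Lemma word_mu_le w l : (word_mu w l <= k)%N.
Proof. by rewrite /word_mu; case: eqP => _; rewrite ?gmu_le ?leq_subr. Qed.

Lemma nth_word_path w i : (i <= L.+1)%N ->
  (word_path w)`_i = ground s t L.+1 - \sum_(i <= l < L.+1) step k (word_mu w l).
Proof.
move=> le_i; rewrite -[in LHS](inordK (le_i : i < L.+2)%N) -(tnth_nth 0).
by rewrite tnth_mktuple inordK.
Qed.

Lemma word_path_step w i : (i <= L)%N ->
  (word_path w)`_i.+1 - (word_path w)`_i = step k (word_mu w i).
Proof.
move=> le_i; rewrite !nth_word_path // 1?leqW // [X in _ - (_ - X)]big_ltn //.
by rewrite opprB addrC addrA subrK addrK.
Qed.

Lemma mu_word_path w i : (i <= L)%N -> mu k (word_path w) i = word_mu w i.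
Proof.
by move=> le_i; apply: mu_step; [exact: word_mu_le | exact: word_path_step].
Qed.

Lemma word_path_last w : (word_path w)`_L.+1 = ground s t L.+1.
Proof. by rewrite nth_word_path // big_geq ?subr0. Qed.

Lemma word_path_prelast w : (word_path w)`_L = ground s t L.
Proof.
rewrite nth_word_path // big_nat1 /word_mu eqxx -ground_step.
by rewrite opprB addrC subrK.
Qed.

Lemma paths_word_path w : paths s t L (word_path w).
Proof.
split=> [i le_i|i le_i||].
- rewrite /Plevel /= nth_word_path // -/(level _) raddfB /= level_ground raddf_sum.
  by rewrite big1 ?subr0 // => l _; apply: level_step.
- by exists (word_mu w i); [exact: word_mu_le | exact: word_path_step].
- exact: word_path_prelast.
- exact: word_path_last.
Qed.

Lemma path_wordK p : paths s t L p -> word_path (path_word p) = p.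
Proof.
move=> [_ pstep pL pL1].
have muP i : (i <= L)%N -> p`_i.+1 - p`_i = step k (mu k p i) /\ (mu k p i <= k)%N.
  by move=> le_i; have [m le_m Dm] := pstep i le_i; rewrite (mu_step p i m le_m Dm).
have wmu i : (i <= L)%N -> word_mu (path_word p) i = mu k p i.
  move=> le_i; rewrite /word_mu; case: eqP => [->|ne].
    by rewrite (mu_step p L (gmu L)) ?gmu_le // pL pL1 ground_step.
  have lt_i : (L.-1 - i < L)%N by lia.
  rewrite (nth_map 0%N) ?size_iota // nth_iota // add0n.
  by rewrite (_ : L.-1 - (L.-1 - i) = i)%N ?subKn ?(muP i le_i).2 //; lia.
apply/val_inj/(@eq_from_nth _ 0); rewrite ?size_tuple // => i lt_i.
rewrite nth_word_path // -pL1.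
rewrite (eq_big_nat _ _ (F2 := fun l => p`_l.+1 - p`_l)); last first.
  by move=> l /andP[_ lt_l]; rewrite wmu // (muP _ _).1.
by rewrite telescope_sumr // opprB addrC subrK.
Qed.

Lemma word_pathK w : w \in words k L -> path_word (word_path w) = w.
Proof.
rewrite mem_words => /andP[/eqP sz /allP wk].
apply: (@eq_from_nth _ 0%N); rewrite size_map size_iota ?sz // => i lt_i.
rewrite (nth_map 0%N) ?size_iota // nth_iota // add0n mu_word_path; last by lia.
rewrite /word_mu ifF; last by apply/eqP; lia.
rewrite (_ : L.-1 - (L.-1 - i) = i)%N; last by lia.
by rewrite subKn // wk // mem_nth ?sz.
Qed.

Lemma path_word_in p : path_word p \in words k L.
Proof.
rewrite mem_words size_map size_iota eqxx /=.
by apply/allP => _ /mapP[i _ ->]; apply: leq_subr.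
Qed.

Lemma word_path_bij : set_bij [set` words k L] (paths s t L) word_path.
Proof.
split.
- by move=> w _; apply: paths_word_path.
- move=> w1 w2 /set_mem w1P /set_mem w2P e.
  by rewrite -(word_pathK _ w1P) e (word_pathK _ w2P).
- by move=> p pP; exists (path_word p); [exact: path_word_in | exact: path_wordK].
Qed.

(** A letter c gives a step with second coordinate k - 2c, so the power of z depends on the word
    only through the sum of its letters. *)
Lemma word_path_head w : w \in words k L ->
  ((word_path w)`_0).2 = (if odd L then s else t)%:Z - (k * L)%:Z + 2 * (sumn w)%:Z.
Proof.
rewrite mem_words => /andP[/eqP sz wall].
have -> : (word_path w)`_0
    = (word_path w)`_L - \sum_(0 <= l < L) step k (word_mu w l).
  rewrite word_path_prelast nth_word_path // big_nat_recr //=.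
  by rewrite /word_mu eqxx -ground_step opprD opprB addrCA [X in _ + X]addrC subrK addrC.
rewrite word_path_prelast weightB_snd ground_snd.
have snd_sum n : (n <= L)%N -> (\sum_(0 <= l < n) step k (word_mu w l)).2
   = \sum_(0 <= l < n) (k%:Z - 2 * (nth 0%N w (L.-1 - l))%:Z).
  elim: n => [|n IHn] le_n; first by rewrite !big_geq.
  rewrite !big_nat_recr // weightD_snd IHn 1?ltnW // step_snd ?word_mu_le //.
  have wk : (nth 0 w (L.-1 - n) <= k)%N.
    by apply: (allP wall); rewrite mem_nth ?sz //; lia.
  by rewrite /word_mu ifF; [congr (_ + _); lia | apply/eqP; lia].
rewrite snd_sum // sumrB sumr_const_nat subn0 -mulr_sumr.
have -> : \sum_(0 <= l < L) (nth 0%N w (L.-1 - l))%:Z = (sumn w)%:Z.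
  rewrite sumnE (big_morph Posz PoszD (erefl _)) (big_nth 0%N) sz [RHS]big_nat_rev.
  by apply: eq_big_nat => l /andP[_ lt_l]; congr (Posz (nth _ _ _)); lia.
rewrite -mulr_natr natz; lia.
Qed.

End PathsAsWords.

(** In the reversed list, positions [size w - j] and [(size w).-1 - j] hold c_(j-1) and c_j; at j =
    [size w] there is no letter c_j, and b stands for k - c_j. *)
Lemma wordexp_sum k b w :
  wordexp k b w = (\sum_(1 <= j < (size w).+1)
    j * maxn (nth 0 w (size w - j))
             (if j == size w then b else k - nth 0 w ((size w).-1 - j)))%N.
Proof.
elim: w b => [|c w IHw] b /=; first by rewrite big_geq.
rewrite [RHS]big_nat_recr //= eqxx subnn addnC; congr (_ + _)%N.
rewrite IHw; apply: eq_big_nat => j /andP[j_gt0 lt_j].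
rewrite subSn //= [X in _ = (_ * maxn _ X)%N]ifF; last by apply/eqP; lia.
congr (_ * maxn _ _)%N; case: eqP => [->|ne]; first by rewrite subnn.
by rewrite (_ : size w - j = ((size w).-1 - j).+1)%N //; lia.
Qed.

(** * Energy and character coefficients in terms of words *)

Section Energy.

Variables (s t L : nat).
Let k := (s + t)%N.

(** Along the ground-state path k - m_(j-1) = m_j by [gmuS], so both arguments of the maximum are
    m_j. *)
Definition ground_exp := (\sum_(1 <= j < L.+1) j * gmu s t j)%N.

Lemma mu_ground_path i : (i <= L)%N -> mu k (ground_path s t L) i = gmu s t i.
Proof.
have nthE l : (l <= L.+1)%N -> (ground_path s t L)`_l = ground s t l.
  move=> le_l; rewrite -[in LHS](inordK (le_l : l < L.+2)%N) -(tnth_nth 0).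
  by rewrite tnth_mktuple inordK.
move=> le_i; apply: mu_step; first exact: gmu_le.
by rewrite !nthE ?ground_step // leqW.
Qed.

Lemma energy_word_path w : w \in words k L ->
  energy s t L (word_path s t L w)
  = (wordexp k (gmu s t L) w)%:Z - ground_exp%:Z.
Proof.
rewrite mem_words => /andP[/eqP sz wall].
rewrite /energy wordexp_sum /ground_exp sz !(big_morph Posz PoszD (erefl _)) -sumrB.
apply: eq_big_nat => -[|j] // lt_jL; rewrite [j.+1.-1]/= -/k.
have le_jL : (j.+1 <= L)%N by [].
rewrite (mu_ground_path j (ltnW le_jL)) (mu_ground_path j.+1 le_jL).
rewrite (mu_word_path s t L w j (ltnW le_jL)) (mu_word_path s t L w j.+1 le_jL).
rewrite -gmuS maxnn mulrBr.
rewrite (PoszM j.+1 (maxn _ _)) (PoszM j.+1 (gmu s t j.+1)).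
congr (_ * Posz (maxn _ _)%N - _).
  rewrite /word_mu ifF; last by apply/eqP; lia.
  have wk : (nth 0%N w (L.-1 - j) <= k)%N.
    by apply: (allP wall); rewrite mem_nth ?sz //; lia.
  by rewrite subKn //; congr nth; lia.
Qed.

(** By [word_path_head], fixing the power of z amounts to fixing the sum A of the letters. A is an
    integer because j may make it negative; the sum is then empty. *)
Lemma F_words (j A : int) :
    2 * A = 2 * j + (k * L)%:Z + (if odd L then t%:Z - s%:Z else 0) ->
  F s t L j = \sum_(w <- words k L | (sumn w)%:Z == A)
                 q ^ ((wordexp k (gmu s t L) w)%:Z - ground_exp%:Z).
Proof.
move=> DA; rewrite /F /ch (reindex_fsbig _ _ _ _ (word_path_bij s t L)).
rewrite -fsbig_seq ?uniq_words // raddf_sum [RHS]big_mkcond.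
apply: eq_big_seq => w ww; rewrite /= mcoeffU energy_word_path //.
rewrite (_ : (_ == _) = ((sumn w)%:Z == A)); first by case: eqP.
rewrite /Defs.form weightB_snd (word_path_head _ _ _ _ ww) ground_snd Lam_snd /= mulr1.
have two_neq0 : 2 != 0 :> rat by [].
rewrite -[LHS](inj_eq (mulIf two_neq0)) divfK //.
have -> : - j%:~R * 2 = (- j * 2)%:~R :> rat by rewrite rmorphM rmorphN.
rewrite eqr_int.
by move: DA; rewrite -/k; case: odd => DA; apply/eqP/eqP; lia.
Qed.

End Energy.

(** * Multinomial terms and their exponents *)

Lemma sumn_ord x : sumn x = (\sum_(i < size x) nth 0 x i)%N.
Proof. by rewrite sumnE (big_nth 0%N) big_mkord. Qed.

Lemma weightsum_sum x : weightsum x = (\sum_(i < size x) i * nth 0 x i)%N.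
Proof.
elim: x => [|a x IHx]; first by rewrite big_ord0.
rewrite [size _]/= big_ord_recl mul0n add0n [weightsum _]/= sumn_ord IHx -big_split.
by apply: eq_bigr => i _; rewrite lift0 mulSn.
Qed.

(** In the expanded squares of the M_l, x_i x_j occurs once for each 1 <= l <= min (i, j); likewise
    x_i occurs min (i, b) times in M_1 + ... + M_b. The proof peels off the head, which lowers every
    index by one. *)
Lemma sqexp_sum b x :
  (sqexp b x + \sum_(i < size x) minn i b * nth 0 x i
  = \sum_(i < size x) \sum_(j < size x) minn i j * nth 0 x i * nth 0 x j)%N.
Proof.
elim: x b => [|a x IHx] b; first by rewrite !big_ord0.
rewrite [size _]/= big_ord_recl [RHS]big_ord_recl min0n mul0n add0n.
rewrite [X in (_ = X + _)%N]big1; last by move=> j _; rewrite min0n !mul0n.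
rewrite add0n; set S := sumn x.
have -> : (\sum_(i < size x) \sum_(j < (size x).+1)
     minn (lift ord0 i) j * nth 0 (a :: x) (lift ord0 i) * nth 0 (a :: x) j
  = S * S + \sum_(i < size x) \sum_(j < size x) minn i j * nth 0 x i * nth 0 x j)%N.
  rewrite /S {1}sumn_ord big_distrl -big_split; apply: eq_bigr => i _ /=.
  rewrite big_ord_recl minn0 !mul0n add0n sumn_ord big_distrr -big_split.
  apply: eq_bigr => j _; rewrite !lift0 minnSS /=; ring.
case: b => [|b] /=.
  rewrite -(IHx 0) addnA; congr (_ + _ + _)%N; apply: eq_bigr => i _ /=.
have -> : (\sum_(i < size x) minn (bump 0 i) b.+1 * nth 0 x i
  = S + \sum_(i < size x) minn i b * nth 0 x i)%N.
  rewrite /S sumn_ord -big_split; apply: eq_bigr => i _.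
  by rewrite minnSS mulSn.
rewrite -(IHx b) /= -/S; case: S => [|S]; rewrite ?mulnS; ring.
Qed.

Lemma qfact_neq0 m : qfact m != 0.
Proof.
rewrite /qfact big_nat; apply: (big_ind (fun x => x != 0)).
- exact: oner_neq0.
- by move=> x y; apply: mulf_neq0.
move=> i /andP[i_gt0 _]; rewrite subr_eq0 /q -tofracXn -tofrac1.
rewrite tofrac_eq; apply/eqP => /(congr1 (fun p : {poly rat} => size p)).
by rewrite size_poly1 size_polyXn; lia.
Qed.

Lemma qfactS m : qfact m.+1 = qfact m * (1 - q ^+ m.+1).
Proof. by rewrite /qfact big_nat_recr. Qed.

Lemma qbinom_qfact a m : qbinom q (a + m) m * (qfact a * qfact m) = qfact (a + m).
Proof.
elim: m => [|m IHm].
  by rewrite qbinom0 addn0 [qfact 0]/qfact big_geq // mul1r mulr1.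
rewrite addnS !qfactS.
transitivity (((1 - q ^+ m.+1) * qbinom q (a + m).+1 m.+1) * (qfact a * qfact m)).
  by ring.
by rewrite mul_qbinom_diag -mulrA IHm mulrC.
Qed.

(** The q-factorials of the successive tail sums telescope, by [qbinom_qfact]. *)
Lemma qchain_qfact x : qchain _ q x = qfact (sumn x) / \prod_(i <- x) qfact i.
Proof.
elim: x => [|a x IHx]; first by rewrite big_nil /= /qfact big_geq // divr1.
rewrite big_cons /= IHx.
have cancel (K : fieldType) (u v w y : K) :
    v != 0 -> u * (w / y) = u * (v * w) / (v * y).
  by move=> v_neq0; rewrite invfM (mulrCA u v) mulrACA mulfV // mul1r mulrA.
by rewrite (cancel _ _ (qfact a)) ?qfact_neq0 // qbinom_qfact.
Qed.

(** * The inverse Cartan form *)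

Section Quadratic.

Variables (k : nat) (v : 'cV[nat]_k.-1).
Hypothesis k_gt0 : (0 < k)%N.

Let k_neq0 : k%:R != 0 :> rat. Proof. by rewrite pnatr_eq0 -lt0n. Qed.

Let vr : 'cV[rat]_k.-1 := map_mx (fun n => n%:R) v.

Definition minform : nat :=
  (\sum_(i < k.-1) \sum_(j < k.-1) minn i.+1 j.+1 * v i 0%R * v j 0%R)%N.

Definition minlin (r : nat) : nat := (\sum_(i < k.-1) minn i.+1 r * v i 0%R)%N.

Let row_ j : (vr^T *m invmx (cartan k)) 0 j =
    (minlin j.+1)%:R - (wsum v)%:R * j.+1%:R / k%:R.
Proof.
rewrite mxE invmx_cartan // /wsum /minlin !natr_sum !mulr_suml -sumrB.
apply: eq_bigr => i _; rewrite !mxE /cinv !natrM; field; exact: k_neq0.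
Qed.

Lemma quad_cartan :
  (vr^T *m invmx (cartan k) *m vr) 0 0 = minform%:R - (wsum v)%:R ^+ 2 / k%:R.
Proof.
rewrite mxE /minform exchange_big natr_sum.
rewrite expr2 {2}/wsum natr_sum mulr_sumr mulr_suml -sumrB.
apply: eq_bigr => j _; rewrite row_ [vr j 0]mxE -big_distrl /= -/(minlin j.+1).
by rewrite -natr_sum -/(wsum v) !natrM; field; exact: k_neq0.
Qed.

(** For 0 < r < k the unit vector picks out one column. For r = 0 and r = k it vanishes, and so does
    the right side, where min (i, r) is 0 or i. *)
Lemma lin_cartan r : (r <= k)%N ->
  (vr^T *m invmx (cartan k) *m unitv k r) 0 0
  = (minlin r)%:R - r%:R * (wsum v)%:R / k%:R.
Proof.
move=> le_rk; pose g b : rat := (minlin b)%:R - (wsum v)%:R * b%:R / k%:R.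
transitivity (g r); last by rewrite /g; field; exact: k_neq0.
rewrite mxE; transitivity (\sum_(j < k.-1) (r == j.+1)%:R * g j.+1).
  by apply: eq_bigr => j _; rewrite row_ !mxE mulrC eq_sym.
case: (posnP r) => [->|r_gt0].
  rewrite big1 => [|j _]; last by rewrite mul0r.
  by rewrite /g /minlin big1 => [|i _]; rewrite ?minn0 ?mul0n // mulr0 mul0r subrr.
under eq_bigr => j _ do rewrite -{1}(prednK r_gt0) eqSS.
rewrite (sum_delta _ _ (fun b => g b.+1)) prednK //.
case: ltnP => // ge_r; have -> : r = k by lia.
rewrite /g mulfK // /minlin /wsum; apply/esym/eqP; rewrite subr_eq0 eqr_nat.
by apply/eqP/eq_bigr => i _; rewrite (minn_idPl _) //; have := ltn_ord i; lia.
Qed.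

End Quadratic.

Lemma qmultinomial_nat M x :
  qmultinomial M [seq m%:R | m <- x]
  = if sumn x == M then qfact M / \prod_(i <- x) qfact i else 0.
Proof.
rewrite /qmultinomial !big_map -natr_sum -sumnE eqr_nat (_ : all _ _) /=.
  by case: eqP => // _; congr (_ / _); apply: eq_bigr => i _; rewrite natrK.
by apply/allP => _ /mapP[m _ ->]; apply: rpred_nat.
Qed.

(** * Sequences with a prescribed interior *)

Section ExtendedSequences.

Variable k : nat.
Hypothesis k_gt0 : (0 < k)%N.
Implicit Types v : 'cV[nat]_k.-1.

Definition seqof v (a b : nat) : seq nat := a :: rcons [seq v i 0 | i : 'I_k.-1] b.

Definition interior (x : seq nat) : 'cV[nat]_k.-1 := \col_i nth 0%N x i.+1.

Lemma size_seqof v a b : size (seqof v a b) = k.-1.+2.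
Proof. by rewrite /= size_rcons size_map size_enum_ord. Qed.

Lemma nth_seqof v a b (i : 'I_k.-1) : nth 0%N (seqof v a b) i.+1 = v i 0.
Proof.
rewrite /= nth_rcons size_map size_enum_ord ltn_ord.
by rewrite (nth_map i) ?size_enum_ord // nth_ord_enum.
Qed.

Lemma seqofK v a b : interior (seqof v a b) = v.
Proof. by apply/matrixP => i j; rewrite mxE nth_seqof (ord1 j). Qed.

Lemma interiorK x : size x = k.+1 ->
  seqof (interior x) (head 0%N x) (last 0%N x) = x.
Proof.
case: x => // a x /= [sz]; rewrite /seqof; congr (_ :: _).
case/lastP: x sz => [|x b]; first by move=> e; exfalso; move: k_gt0; rewrite -e.
rewrite size_rcons last_rcons => sz; congr rcons.
apply: (@eq_from_nth _ 0%N); rewrite size_map size_enum_ord; first by rewrite -sz.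
move=> i lt_i; rewrite (nth_map (Ordinal lt_i)) ?size_enum_ord // mxE /=.
by rewrite nth_enum_ord // nth_rcons ifT //; lia.
Qed.

Lemma big_seqof (V : nmodType) (f : nat -> nat -> V) v a b :
  \sum_(i < size (seqof v a b)) f i (nth 0%N (seqof v a b) i)
  = f 0%N a + \sum_(i < k.-1) f i.+1 (v i 0) + f k b.
Proof.
rewrite size_seqof big_ord_recl big_ord_recr /= addrA; congr (_ + _ + _).
  by apply: eq_bigr => i _; rewrite -(nth_seqof v a b).
rewrite /bump leq0n add1n prednK //=.
by rewrite add0n nth_rcons size_map size_enum_ord ltnn eqxx.
Qed.

Lemma weightsum_seqof v a b : weightsum (seqof v a b) = (wsum v + k * b)%N.
Proof.
by rewrite weightsum_sum (big_seqof _ (fun i y => i * y)%N) mul0n add0r.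
Qed.

Lemma sumn_seqof v a b : sumn (seqof v a b) = (a + \sum_(i < k.-1) v i 0%R + b)%N.
Proof. by rewrite sumn_ord (big_seqof _ (fun i y => y)%N). Qed.

Lemma cowsum_wsum v : (cowsum v + wsum v = k * \sum_(i < k.-1) v i 0%R)%N.
Proof.
rewrite /cowsum /wsum -big_split big_distrr; apply: eq_bigr => i _ /=.
by rewrite -mulnDl subnK //; have := ltn_ord i; lia.
Qed.

Lemma extend_seqof v a b :
  extend a%:R v b%:R = [seq m%:R | m <- seqof v a b].
Proof. by rewrite /extend /seqof /= map_rcons -map_comp. Qed.

(** This is [sqexp_sum] with the ends split off: index 0 has weight 0, and since min (i, k) = i the
    last entry b yields the cross term and k b^2. *)
Lemma sqexp_seqof v a b r : (r <= k)%N ->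
  (sqexp r (seqof v a b) + (minlin k v r + r * b)
  = minform k v + 2 * wsum v * b + k * b * b)%N.
Proof.
move=> le_rk; have := sqexp_sum r (seqof v a b).
rewrite (big_seqof _ (fun i y => minn i r * y)%N) min0n mul0n add0r (minn_idPr le_rk).
move=> ->; set x := seqof v a b.
rewrite (big_seqof _ (fun i y => \sum_(j < size x) minn i j * y * nth 0%N x j)%N).
have inner i y : (\sum_(j < size x) minn i j * y * nth 0%N x j
    = \sum_(j < k.-1) minn i j.+1 * y * v j 0%R + minn i k * y * b)%N.
  by rewrite (big_seqof _ (fun j z => minn i j * y * z)%N) minn0 !mul0n add0r.
rewrite !inner minnn big1 => [|i _]; last by rewrite min0n !mul0n.
rewrite min0n !mul0n !add0r.
have -> : (\sum_(j < k.-1) minn k j.+1 * b * v j 0%R = wsum v * b)%N.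
  rewrite /wsum big_distrl; apply: eq_bigr => j _ /=.
  by rewrite (minn_idPr _); [ring | have := ltn_ord j; lia].
under eq_bigr => i _ do rewrite inner.
rewrite big_split /=.
have -> : (\sum_(i < k.-1) minn i.+1 k * v i 0%R * b = wsum v * b)%N.
  rewrite /wsum big_distrl; apply: eq_bigr => j _ /=.
  by rewrite (minn_idPl _) //; have := ltn_ord j; lia.
rewrite -/(minform k v) -[RHS]/(_ + _ + _)%N; ring.
Qed.

(** With A = [wsum v + k * b], completing the square turns the Cartan form into [sqexp] plus (r A -
    A^2)/k; adding j (j + t)/k makes this correction the integer e. *)
Lemma expo_seqof v a b (r t : nat) (j e : int) : (r <= k)%N ->
    (let A := (weightsum (seqof v a b))%:Z in
     j * (j + t%:Z) - A ^+ 2 + r%:Z * A = k%:Z * e) ->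
  expo r t j v = (e + (sqexp r (seqof v a b))%:Z)%:~R.
Proof.
move=> le_rk; rewrite weightsum_seqof; cbv zeta.
move: (sqexp_seqof v a b r le_rk); move: (sqexp r _) => m Dm De.
have k_neq0 : k%:R != 0 :> rat by rewrite pnatr_eq0 -lt0n.
rewrite /expo; cbv zeta; rewrite quad_cartan // lin_cartan //.
have {}Dm : (minform k v)%:R = m%:R + ((minlin k v r)%:R + r%:R * b%:R)
    - 2 * (wsum v)%:R * b%:R - k%:R * b%:R * b%:R :> rat.
  have := congr1 (fun n : nat => n%:R : rat) Dm.
  by rewrite !(natrD, natrM) => ->; ring.
have {}De : j%:~R * (j%:~R + t%:R) - ((wsum v)%:R + k%:R * b%:R) ^+ 2
    + r%:R * ((wsum v)%:R + k%:R * b%:R) = k%:R * e%:~R :> rat.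
  have := congr1 (fun n : int => n%:~R : rat) De.
  by rewrite PoszD PoszM !(rmorphD, rmorphM, rmorphB, rmorphXn, rmorphN).
rewrite rmorphM !rmorphD /= {}Dm.
apply: (mulfI k_neq0). rewrite [RHS]mulrDr -De -[m%:~R]/(m%:R) -[t%:~R]/(t%:R).
field; exact: k_neq0.
Qed.

(** Solving the linear equations for the sum and the weighted sum recovers both ends from the
    interior; this is where the formulas for x_0 and x_k come from. *)
Lemma ends_seqof v a b :
  (sumn (seqof v a b))%:R
    - k%:R^-1 * ((cowsum v)%:R + (weightsum (seqof v a b))%:R) = a%:R :> rat
  /\ k%:R^-1 * ((weightsum (seqof v a b))%:R - (wsum v)%:R) = b%:R :> rat.
Proof.
have k_neq0 : k%:R != 0 :> rat by rewrite pnatr_eq0 -lt0n.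
have := congr1 (fun m : nat => m%:R : rat) (cowsum_wsum v).
rewrite weightsum_seqof sumn_seqof /= !(natrD, natrM) => Dcw.
have -> : (cowsum v)%:R = k%:R * (\sum_(i < k.-1) v i 0%R)%:R - (wsum v)%:R :> rat.
  by rewrite -Dcw addrK.
by split; field; exact: k_neq0.
Qed.

End ExtendedSequences.

(** * The character coefficients as multinomial sums *)

Lemma q_neq0 : q != 0.
Proof. by rewrite /q tofrac_eq0 polyX_eq0. Qed.

Section Character.

Variables (s t L : nat) (j A : int).
Let k := (s + t)%N.
Let r := gmu s t L.
Hypothesis k_gt0 : (0 < k)%N.
Hypothesis DA : 2 * A = 2 * j + (k * L)%:Z + (if odd L then t%:Z - s%:Z else 0).

(** The prefactor exponent of [wordsum] after division by q^(L * A), less the constant of the ground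
    state. *)
Definition shift_exp : int :=
  (r * L + k * 'C(L, 2))%:Z + A - L%:Z * A - (ground_exp s t L)%:Z.

Lemma F_compositions :
  F s t L j = \sum_(x <- compositions k L | (weightsum x)%:Z == A)
                 q ^ (shift_exp + (sqexp r x)%:Z) * qchain _ q x.
Proof.
rewrite (F_words s t L j A DA) -/k -/r /shift_exp.
(* For negative A both sums are empty. *)
case: A => [n|n]; last by rewrite !big_pred0.
have qD := expfzDr _ _ q_neq0.
set G := ground_exp s t L.
transitivity (q ^ (- G%:Z) * \sum_(w <- words k L | sumn w == n) q ^+ wordexp k r w).
  by rewrite mulr_sumr; apply: eq_bigr => w _; rewrite addrC qD.
transitivity (q ^ ((r * L + k * 'C(L, 2))%:Z + n%:Z - L%:Z * n%:Z - G%:Z)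
              * compsum _ q k L r n); last first.
  rewrite /compsum mulr_sumr; apply: eq_bigr => x _.
  by rewrite (qD _ (sqexp r x)%:Z) -[RHS]mulrA.
have -> : - G%:Z = (- G%:Z - L%:Z * n%:Z) + (L * n)%:Z by rewrite PoszM subrK.
rewrite (qD _ (L * n)%:Z) -mulrA -[q ^ (L * n)%:Z]/(q ^+ (L * n)) wordsum ?gmu_le //.
rewrite -[q ^+ (_ + n)]/(q ^ (_ + n)%:Z) mulrA -qD.
by congr (q ^ _ * _); rewrite -/k; lia.
Qed.

Hypothesis shiftE : j * (j + t%:Z) - A ^+ 2 + r%:Z * A = k%:Z * shift_exp.

(** Dropping the ends maps the compositions of L with weighted sum A injectively to vectors v, since
    v determines the ends. A vector outside the image has multinomial 0, and the image satisfies the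
    congruence because A = c + k n. *)
Lemma F_multinomial (c n : int) : A = c + k%:Z * n ->
  F s t L j =
  \sum_(v \in [set v : 'cV[nat]_k.-1 | exists m : int, (wsum v)%:Z = c + k%:Z * m])
    qpow (expo r t j v) *
    qmultinomial L (extend (L%:R - k%:R^-1 * ((cowsum v)%:R + A%:~R)) v
                           (k%:R^-1 * (A%:~R - (wsum v)%:R))).
Proof.
move=> Dc; pose ends (v : 'cV[nat]_k.-1) : rat * rat :=
  (L%:R - k%:R^-1 * ((cowsum v)%:R + A%:~R), k%:R^-1 * (A%:~R - (wsum v)%:R)).
have k_neq0 : k%:R != 0 :> rat by rewrite pnatr_eq0 -lt0n.
pose cs := [seq x <- compositions k L | (weightsum x)%:Z == A].
have csP x : x \in cs ->
  [/\ seqof k (interior k x) (head 0%N x) (last 0%N x) = x,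
      sumn x = L & (weightsum x)%:Z = A].
  rewrite mem_filter mem_compositions => /and3P[/eqP Dw /eqP sz /eqP Ds].
  by split=> //; apply: interiorK.
have endsP v a b : sumn (seqof k v a b) = L -> (weightsum (seqof k v a b))%:Z = A ->
    ends v = (a%:R, b%:R).
  by move=> DL Aw; have [<- <-] := ends_seqof k k_gt0 v a b; rewrite /ends -Aw DL.
pose G v := qpow (expo r t j v) * qmultinomial L (extend (ends v).1 v (ends v).2).
have G0 v : G v <> 0 -> exists2 x, x \in cs & interior k x = v.
  rewrite /G => nz; have {}nz : qmultinomial L (extend (ends v).1 v (ends v).2) != 0.
    by apply/eqP => e; apply: nz; rewrite e mulr0.
  have /allP ints : all (fun m => m \is a Num.nat) (extend (ends v).1 v (ends v).2).
    by apply: contraNT nz => /negPf h; rewrite /qmultinomial h.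
  have /ints/natrP[a Da] : (ends v).1 \in extend (ends v).1 v (ends v).2.
    by rewrite mem_head.
  have /ints/natrP[b Db] : (ends v).2 \in extend (ends v).1 v (ends v).2.
    by rewrite inE mem_rcons mem_head orbT.
  move: nz; rewrite Da Db extend_seqof qmultinomial_nat.
  case: (sumn _ =P L) => [DL _|_]; last by rewrite eqxx.
  exists (seqof k v a b); last exact: seqofK.
  rewrite mem_filter mem_compositions size_seqof DL prednK // !eqxx !andbT.
  rewrite weightsum_seqof // -(eqr_int rat); apply/eqP.
  rewrite -[LHS]/((wsum v + k * b)%N%:R) natrD natrM -Db /=.
  by field; exact: k_neq0.
have Gcs x : x \in cs -> G (interior k x) =
    q ^ (shift_exp + (sqexp r x)%:Z) * qchain _ q x.
  move=> /csP[Dx Ds Dw]; set v := interior k x in Dx *.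
  rewrite /G (endsP v (head 0%N x) (last 0%N x)) ?Dx // extend_seqof Dx.
  rewrite qmultinomial_nat Ds eqxx qchain_qfact Ds; congr (_ * _).
  rewrite (expo_seqof k k_gt0 v (head 0%N x) (last 0%N x) r t j shift_exp) ?gmu_le //.
    by rewrite /qpow intrKfloor Dx.
  by rewrite Dx Dw.
rewrite F_compositions -big_filter -/cs.
rewrite -[RHS]/(\sum_(v \in _) G v).
rewrite -(fsbig_widen (interior k @` [set` cs])); first last.
- move=> v [_ Nv]; apply: contrapT => /G0[x xcs Dx]; apply: Nv; by exists x.
- move=> _ [x /csP[Dx _ Dw] <-]; exists (n - (last 0%N x)%:Z).
  by move: Dw; rewrite -{1}Dx weightsum_seqof // Dc PoszD PoszM; lia.
rewrite (reindex_fsbig (interior k) [set` cs]); last first.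
  split; [by move=> x xcs; exists x | | by move=> v].
  move=> x y /set_mem xcs /set_mem ycs e.
  have [[Dx Lx Ax] [Dy Ly Ay]] := (csP _ xcs, csP _ ycs).
  have := endsP (interior k x) (head 0%N x) (last 0%N x); rewrite Dx => /(_ Lx Ax).
  have := endsP (interior k y) (head 0%N y) (last 0%N y); rewrite Dy => /(_ Ly Ay).
  rewrite e => -> [/eqP + /eqP]; rewrite !eqr_nat => /eqP h /eqP l.
  by rewrite -Dx -Dy e h l.
rewrite -fsbig_seq ?filter_uniq ?uniq_compositions //.
by apply: eq_big_seq => x xcs; rewrite Gcs.
Qed.

End Character.

(** * Constants for the two parities of L *)

Lemma ground_expS s t L :
  ground_exp s t L.+1 = (ground_exp s t L + L.+1 * gmu s t L.+1)%N.
Proof. exact: big_nat_recr. Qed.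

Lemma ground_exp_double s t n :
  ground_exp s t n.*2 = (s * (n * n.+1) + t * (n * n))%N.
Proof.
elim: n => [|n IHn]; first by rewrite /ground_exp big_geq // !muln0.
rewrite doubleS !ground_expS IHn /gmu /= odd_double /= -!muln2.
lia.
Qed.

Lemma ground_exp_doubleS s t n :
  ground_exp s t n.*2.+1 = (s * (n * n.+1) + t * (n.+1 * n.+1))%N.
Proof.
rewrite ground_expS ground_exp_double /gmu /= odd_double /= -!muln2.
lia.
Qed.

Lemma bin_double2 n : ('C(n.*2, 2)%:Z = n%:Z * (2 * n%:Z - 1))%R.
Proof.
elim: n => [|n IHn]; first by [].
by rewrite doubleS !binS !bin1 bin0 !PoszD IHn -muln2; lia.
Qed.

(** This supplies [shiftE] for L = 2n, where r = s and A solves the relation required by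
    [F_words]. *)
Lemma shift_exp_even s t n (j : int) :
  let A := j + (s + t)%:Z * n%:Z in
  j * (j + t%:Z) - A ^+ 2 + (gmu s t n.*2)%:Z * A
  = (s + t)%:Z * shift_exp s t n.*2 A.
Proof.
rewrite /shift_exp /gmu odd_double ground_exp_double !PoszD !PoszM bin_double2.
by rewrite PoszD -muln2 PoszM intS; ring.
Qed.

Lemma shift_exp_odd s t n (j : int) :
  let A := j + t%:Z + (s + t)%:Z * n%:Z in
  j * (j + t%:Z) - A ^+ 2 + (gmu s t n.*2.+1)%:Z * A
  = (s + t)%:Z * shift_exp s t n.*2.+1 A.
Proof.
rewrite /shift_exp /gmu /= odd_double ground_exp_doubleS binS bin1 !PoszD !PoszM.
by rewrite !PoszD bin_double2 -muln2 PoszM !intS PoszM; ring.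
Qed.

Theorem theorem4 (s t L : nat) (j : int) (hk : (1 <= s + t)%N) :
  let k := (s + t)%N in
  (~~ odd L ->
    F s t L j =
    \sum_(x \in [set x : 'cV[nat]_k.-1 |
                  exists n : int, (wsum x)%:Z = j + k%:Z * n])
      qpow (expo s t j x) *
      qmultinomial L
        (extend (L%:R / 2 - k%:R^-1 * ((cowsum x)%:R + j%:~R))
                x
                (L%:R / 2 - k%:R^-1 * ((wsum x)%:R - j%:~R))))
  /\
  (odd L ->
    F s t L j =
    \sum_(x \in [set x : 'cV[nat]_k.-1 |
                  exists n : int, (wsum x)%:Z = j + t%:Z + k%:Z * n])
      qpow (expo t t j x) *
      qmultinomial L
        (extend ((L%:R + 1) / 2 - k%:R^-1 * ((cowsum x)%:R + j%:~R + t%:R))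
                x
                ((L%:R - 1) / 2 - k%:R^-1 * ((wsum x)%:R - j%:~R - t%:R)))).
Proof.
move=> k; have k_neq0 : k%:R != 0 :> rat by rewrite pnatr_eq0 -lt0n.
rewrite -(odd_double_half L); move: L./2 => n.
have n2 : n.*2%:R = 2 * n%:R :> rat by rewrite -mul2n natrM.
have castA (c : int) (d : nat) :
    (c + d%:Z * n%:Z)%:~R = c%:~R + d%:R * n%:R :> rat.
  by rewrite rmorphD rmorphM.
case: (odd L); rewrite ?add0n ?add1n; split; rewrite /= odd_double // => _.
  (* For L = 2n + 1 the sum of the letters is A = j + t + k n; L - n = (L + 1)/2 and n = (L - 1)/2
     give the end entries. *)
  rewrite (F_multinomial _ _ _ _ (j + t%:Z + k%:Z * n%:Z) hk _
            (shift_exp_odd _ _ _ _) _ n (erefl _)).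
    rewrite /gmu /= odd_double /=.
    apply: eq_fsbigr => x _; congr (_ * qmultinomial _ (extend _ x _)).
      rewrite -natr1 n2 castA rmorphD /=; field; rewrite -?natrD; exact: k_neq0.
    rewrite -natr1 n2 castA rmorphD /=; field; rewrite -?natrD; exact: k_neq0.
  by rewrite /= odd_double -/k /=; lia.
(* For L = 2n it is A = j + k n, and L - n = n = L/2. *)
rewrite (F_multinomial _ _ _ _ (j + k%:Z * n%:Z) hk _
          (shift_exp_even _ _ _ _) _ n (erefl _)).
  rewrite /gmu odd_double /=.
  apply: eq_fsbigr => x _; congr (_ * qmultinomial _ (extend _ x _)).
    rewrite n2 castA -/k; field; rewrite -?natrD; exact: k_neq0.
  rewrite n2 castA -/k; field; rewrite -?natrD; exact: k_neq0.
by rewrite odd_double -/k /=; lia.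
Qed.
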